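(* There is an absolute constant $C>0$ such that the following holds. Let $f:\mathbb{R}^d\to\mathbb{R}$ be differentiable, attain its minimum $f^*:=\min_{x\in\mathbb{R}^d}f(x)$, and be $L$-smooth ($L>0$), i.e. $\|\nabla f(x)-\nabla f(y)\|\le L\|x-y\|$ for all $x,y\in\mathbb{R}^d$. Suppose $f$ satisfies the PL condition with $\mu>0$: $\|\nabla f(x)\|^2\ge2\mu(f(x)-f^* )$ for all $x\in\mathbb{R}^d$. Let the oracle noise satisfy $|\delta(x)|^2\le\Delta^2$ for all $x\in\mathbb{R}^d$ ($\Delta>0$). Let $\tau>0$ and let $(x^k)_{k\ge0}$ be generated by GD via JAGUAR (see context) with smoothing parameter $\tau$, any $x^0\in\mathbb{R}^d$ and constant step size $\gamma=\frac{1}{4dL}$. Then, with $F_0:=f(x^0)-f^*$, for every $N\ge0$ $$\mathbb{E}\big[f(x^N)-f^*\big]\le C\left(F_0\exp\left[-\frac{\mu N}{4dL}\right]+\frac{dL^2\tau^2+d\Delta^2/\tau^2}{\mu}\right).$$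
   Context: $\|\cdot\|$ is the Euclidean norm on $\mathbb{R}^d$ and $e_1,\dots,e_d$ the standard basis. $\delta:\mathbb{R}^d\to\mathbb{R}$ is the oracle noise; only the noisy values $f_\delta(x):=f(x)+\delta(x)$ are available. Full approximation: $\widetilde\nabla f_\delta(x):=\sum_{i=1}^d\frac{f_\delta(x+\tau e_i)-f_\delta(x-\tau e_i)}{2\tau}e_i$. GD via JAGUAR: start from $x^0\in\mathbb{R}^d$, $h^0=\widetilde\nabla f_\delta(x^0)$. For $k=0,1,2,\dots$: sample $i_k$ uniformly from $\{1,\dots,d\}$, independently of everything before; set $h^{k+1}=h^k-\langle h^k,e_{i_k}\rangle e_{i_k}+\frac{f_\delta(x^k+\tau e_{i_k})-f_\delta(x^k-\tau e_{i_k})}{2\tau}e_{i_k}$; set $x^{k+1}=x^k-\gamma h^{k+1}$. The expectation is over the random indices $i_k$. *)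

(* Defs.v *)
From HB Require Import structures.
From mathcomp Require Export all_boot all_order all_algebra.
From mathcomp Require Export all_classical all_reals all_analysis.
Export Order.TTheory GRing.Theory Num.Theory.
Export numFieldNormedType.Exports.

Set Implicit Arguments.
Unset Strict Implicit.
Unset Printing Implicit Defensive.

Local Open Scope classical_set_scope.
Local Open Scope ring_scope.

Section Euclidean.
Context {R : realType} {d : nat}.
Implicit Types (x y : 'rV[R]_d) (f : 'rV[R]_d -> R).

Definition dotp x y : R := \sum_(i < d) x 0 i * y 0 i.

(* The library norm [`|x|] on ['rV[R]_d] is the sup norm; it induces the same
   topology, hence the same notion of differentiability, but the norm in
   smoothness and PL conditions is the Euclidean one. *)
Definition enorm x : R := Num.sqrt (dotp x x).

Definition ebasis (i : 'I_d) : 'rV[R]_d := delta_mx 0 i.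

Definition grad f x : 'rV[R]_d := \row_(i < d) 'D_(ebasis i) f x.

Definition is_minimum f (m : R) : Prop :=
  (exists x, f x = m) /\ (forall x, m <= f x).

Definition smooth (L : R) f : Prop :=
  forall x y, enorm (grad f x - grad f y) <= L * enorm (x - y).

Definition PL (mu : R) f (fstar : R) : Prop :=
  forall x, 2 * mu * (f x - fstar) <= enorm (grad f x) ^+ 2.

End Euclidean.

Section Jaguar.
Context {R : realType} {d : nat}.
(* [g] is the available (noisy) oracle, [tau] the smoothing parameter,
   [gamma] the step size. *)
Variables (g : 'rV[R]_d -> R) (tau gamma : R).

Definition central_diff (x : 'rV[R]_d) (i : 'I_d) : R :=
  (g (x + tau *: ebasis i) - g (x - tau *: ebasis i)) / (2 * tau).

Definition full_approx (x : 'rV[R]_d) : 'rV[R]_d :=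
  \sum_(i < d) central_diff x i *: ebasis i.

Definition jaguar_update (x h : 'rV[R]_d) (i : 'I_d) : 'rV[R]_d :=
  h - dotp h (ebasis i) *: ebasis i + central_diff x i *: ebasis i.

(* The pair [(x^k, h^k)] along the index sequence [idx]. *)
Fixpoint jaguar (x0 : 'rV[R]_d) (idx : nat -> 'I_d) (k : nat) :
    'rV[R]_d * 'rV[R]_d :=
  match k with
  | 0 => (x0, full_approx x0)
  | k'.+1 =>
      let: (x, h) := jaguar x0 idx k' in
      let h' := jaguar_update x h (idx k') in
      (x - gamma *: h', h')
  end.

Definition jaguar_iterate x0 idx k : 'rV[R]_d := (jaguar x0 idx k).1.

End Jaguar.

Section Sampling.
Context {R : realType} {d : nat} {disp : measure_display}
  {T : measurableType disp}.
Variables (P : probability T R) (I : nat -> T -> 'I_d).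

Definition past (k : nat) (w : T) : k.-tuple 'I_d := [tuple I m w | m < k].

(* ['I_d] carries the discrete sigma-algebra.  The third clause says that [I k]
   is independent of the random element [(I 0, ..., I (k-1))]; since the
   starting point is deterministic, this is the whole past of the algorithm. *)
Definition uniform_fresh_sampling : Prop :=
  [/\ forall k (B : set 'I_d), measurable (I k @^-1` B),
      forall k (i : 'I_d), P (I k @^-1` [set i]) = (d%:R^-1)%:E
    & forall k (A : set (k.-tuple 'I_d)) (B : set 'I_d),
        P ((past k @^-1` A) `&` (I k @^-1` B)) =
        (P (past k @^-1` A) * P (I k @^-1` B))%E ].

End Sampling.

(* Main.v *)
(* For the joint state (x, h) consider the potential
     Phi(x, h) = f(x) - fstar + 2 gamma d |h - grad f(x)|^2.
   The descent lemma and PL give, for x' = x - gamma h',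
     f(x') - fstar <= (1 - gamma mu)(f(x) - fstar)
                      - gamma/2 (1 - L gamma) |h'|^2 + gamma/2 |h' - grad f(x)|^2,
   the negative term pays for the drift of the gradient between x and x', and
   refreshing a uniform coordinate of h contracts |h - grad f(x)|^2 by 1 - 1/d
   in mean, up to 1/d times the squared bias of the central differences.  Hence
   the conditional mean of Phi contracts by 1 - gamma mu at each step, up to an
   additive O(gamma) times the squared bias, and the geometric series sums to
   O(1/mu) times that bias.  The weight 2 gamma d makes the two rates match
   when gamma mu <= 1/(4d), i.e. mu <= L; if mu > L, then PL and smoothness
   force f = fstar everywhere. *)
Require Import Defs.
From mathcomp Require Import all_boot all_order all_algebra.
From mathcomp Require Import all_classical all_reals all_analysis.
From mathcomp Require Import measurable_realfun ring lra.
Import Order.TTheory GRing.Theory Num.Theory.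
Import numFieldNormedType.Exports.

Local Open Scope classical_set_scope.
Local Open Scope ring_scope.

(** * Euclidean inner product, gradients and smoothness *)

Section EuclideanTheory.
Context {R : realType} {d : nat}.
Implicit Types (x y z v : 'rV[R]_d) (f : 'rV[R]_d -> R).

Lemma dotpC x y : dotp x y = dotp y x.
Proof. by apply: eq_bigr => i _; rewrite mulrC. Qed.

Lemma dotpDl x y z : dotp (x + y) z = dotp x z + dotp y z.
Proof. by rewrite -big_split; apply: eq_bigr => i _; rewrite mxE mulrDl. Qed.

Lemma dotpZl a x y : dotp (a *: x) y = a * dotp x y.
Proof. by rewrite mulr_sumr; apply: eq_bigr => i _; rewrite mxE mulrA. Qed.

Lemma dotpNl x y : dotp (- x) y = - dotp x y.
Proof. by rewrite -scaleN1r dotpZl mulN1r. Qed.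

Lemma dotpDr x y z : dotp x (y + z) = dotp x y + dotp x z.
Proof. by rewrite dotpC dotpDl !(dotpC x). Qed.

Lemma dotpZr a x y : dotp x (a *: y) = a * dotp x y.
Proof. by rewrite dotpC dotpZl (dotpC x). Qed.

Lemma dotpNr x y : dotp x (- y) = - dotp x y.
Proof. by rewrite dotpC dotpNl (dotpC x). Qed.

Definition dotpE := (dotpDl, dotpDr, dotpNl, dotpNr, dotpZl, dotpZr).

Lemma dotp_ge0 x : 0 <= dotp x x.
Proof. by apply: sumr_ge0 => i _; rewrite -expr2 sqr_ge0. Qed.

Lemma enorm_ge0 x : 0 <= enorm x.
Proof. exact: sqrtr_ge0. Qed.

Lemma sqr_enorm x : enorm x ^+ 2 = dotp x x.
Proof. by rewrite sqr_sqrtr// dotp_ge0. Qed.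

Lemma dotp_ebasis x (i : 'I_d) : dotp x (ebasis i) = x 0 i.
Proof.
rewrite /dotp (bigD1 i)//= big1 ?addr0 => [|j ji]; rewrite mxE !eqxx/= ?mulr1//.
by rewrite (negbTE ji) mulr0.
Qed.

Lemma dotp_ebasis_diag (i : 'I_d) : dotp (ebasis i) (ebasis i) = 1 :> R.
Proof. by rewrite dotp_ebasis mxE !eqxx. Qed.

Lemma dotp_sqrD x y :
  dotp (x + y) (x + y) = dotp x x + 2 * dotp x y + dotp y y.
Proof. by rewrite !dotpE (dotpC y); ring. Qed.

(** Replaces Cauchy-Schwarz below, so that every estimate stays in squared norms. *)
Lemma dotp_young a x y : 2 * a * dotp x y <= a ^+ 2 * dotp x x + dotp y y.
Proof.
have := dotp_ge0 (a *: x - y); rewrite !dotpE (dotpC y x); lra.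
Qed.

Lemma smooth_sqr {L : R} {f} : 0 < L -> smooth L f -> forall x y,
  dotp (grad f x - grad f y) (grad f x - grad f y)
  <= L ^+ 2 * dotp (x - y) (x - y).
Proof.
move=> L0 sf x y; rewrite -!sqr_enorm -exprMn ler_sqr ?nnegrE ?enorm_ge0 ?sf//.
by rewrite mulr_ge0 ?enorm_ge0// ltW.
Qed.

Lemma derive_grad f x v : differentiable f x -> 'D_v f x = dotp (grad f x) v.
Proof.
move=> df; rewrite deriveE// [in LHS](row_sum_delta v) linear_sum.
by apply: eq_bigr => i _; rewrite linearZ/= mxE -deriveE// mulrC.
Qed.

(** The difference quotient of the restriction to the line at [t] is the same function of [h] as the
    directional quotient of [f] at [x + t *: v], so no chain rule intervenes. *)
Lemma is_derive_line f x v (t : R) : differentiable f (x + t *: v) ->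
  is_derive t (1 : R) (fun s : R => f (x + s *: v)) (dotp (grad f (x + t *: v)) v).
Proof.
move=> df.
pose q (h : R) := h^-1 *: ((f \o shift (x + t *: v)) (h *: v) - f (x + t *: v)).
have E : q = fun h : R =>
    h^-1 *: (((fun s : R => f (x + s *: v)) \o shift t) (h *: (1 : R)) - f (x + t *: v)).
  apply/funext => h; congr (_ *: (f _ - _)) => /=.
  by rewrite scalerDl addrCA [h *: 1]mulr1.
apply: DeriveDef; first by rewrite /derivable -E; exact: diff_derivable.
by rewrite -derive_grad// /derive -E.
Qed.

(** Instead of integrating the gradient, one shows that the remainder along the segment minus its
    quadratic bound is nonincreasing on [0, 1]. *)
Lemma descent {L : R} {f} : 0 < L -> (forall x, differentiable f x) -> smooth L f ->
  forall x v, `|f (x + v) - f x - dotp (grad f x) v| <= L / 2 * dotp v v.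
Proof.
move=> L0 df sf x v.
(* The sign [s], equal to 1 or -1, treats both sides of the absolute value at once. *)
have key (s : R) : s ^+ 2 = 1 ->
    s * (f (x + v) - f x - dotp (grad f x) v) <= L / 2 * dotp v v.
  move=> s1.
  pose phi := fun t : R => s * (f (x + t *: v) - t * dotp (grad f x) v)
                           - L / 2 * dotp v v * t ^+ 2.
  pose dphi := fun t : R => s * dotp (grad f (x + t *: v) - grad f x) v
                           - L * dotp v v * t.
  have D t : is_derive t (1 : R) phi (dphi t).
    have := @is_derive_line f x v t (df _) => ?.
    rewrite /phi; apply: is_derive_eq.
    by rewrite /dphi !dotpE /GRing.scale/= ?expr1 ?expr0; field.
  have : phi 1 <= phi 0.
    apply: (@ler0_derive1_le_cc _ phi 0 1 _ _ _ 1 0); rewrite ?in_itv/= ?lexx ?ler01//.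
    - move=> t /andP[t0 t1]; rewrite derive1E derive_val /dphi.
      (* After multiplication by [L * t], Young with factor [s * (L * t)] and smoothness each
         contribute [(L * t)^2 |v|^2], twice which is what the quadratic term cancels. *)
      have Lt0 : 0 < L * t by rewrite mulr_gt0.
      have Y := dotp_young (s * (L * t)) v (grad f (x + t *: v) - grad f x).
      have S := smooth_sqr L0 sf (x + t *: v) x.
      have xtv : x + t *: v - x = t *: v by rewrite addrC addKr.
      rewrite xtv !dotpZl !dotpZr in S.
      rewrite (dotpC v) exprMn s1 mul1r in Y.
      rewrite -(pmulr_rle0 _ Lt0).
      nra.
    - by apply: derivable_within_continuous => t _; apply: ex_derive.
  rewrite /phi !scale0r scale1r addr0; lra.
rewrite ler_norml; apply/andP; split.
  by have := key (-1) ltac:(by rewrite sqrrN expr1n); lra.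
by have := key 1 (expr1n _ _); lra.
Qed.

(** A gradient step of size [1/L] lowers [f] by at least |grad f|^2 / (2L), yet cannot go below the
    minimum. *)
Lemma grad_sqr_le {L : R} {f} {m : R} : 0 < L -> (forall x, differentiable f x) ->
  smooth L f -> is_minimum f m -> forall x,
  dotp (grad f x) (grad f x) <= 2 * L * (f x - m).
Proof.
move=> L0 df sf [_ fm] x.
have := descent L0 df sf x (- L^-1 *: grad f x).
rewrite !dotpE => /ler_normlP[_].
have := fm (x + - L^-1 *: grad f x).
set y := f (x + _); set g := dotp _ _ => my yle.
have -> : g = 2 * L * (L^-1 * g - L / 2 * (L^-1 * (L^-1 * g))).
  by field; rewrite gt_eqF.
rewrite ler_pM2l ?mulr_gt0//; lra.
Qed.

End EuclideanTheory.

(** * Bias of the central differences and one JAGUAR step *)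

Definition sq_bias {R : realType} (L Delta tau : R) : R :=
  L ^+ 2 * tau ^+ 2 / 2 + 2 * (Delta ^+ 2 / tau ^+ 2).

Section JaguarStep.
Context {R : realType} {d : nat}.
Variables (f delta : 'rV[R]_d -> R) (fstar L mu Delta tau gamma : R).
Hypotheses (d_gt0 : (0 < d)%N) (df : forall x, differentiable f x).
Hypotheses (fmin : is_minimum f fstar) (L_gt0 : 0 < L) (sf : smooth L f).
Hypotheses (mu_gt0 : 0 < mu) (plf : PL mu f fstar).
Hypotheses (Delta_gt0 : 0 < Delta).
Hypotheses (deltaP : forall x, `|delta x| ^+ 2 <= Delta ^+ 2) (tau_gt0 : 0 < tau).
Hypothesis gamma_def : gamma = 1 / (4 * d%:R * L).
Implicit Types (x h p : 'rV[R]_d).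

Local Notation g := (fun x => f x + delta x).
Local Notation bias2 := (sq_bias L Delta tau).

(** In the numerator, the two descent remainders cost [L tau^2 / 2] each and the two noise values
    [Delta] each. Squaring by (a + b)^2 <= 2 a^2 + 2 b^2 and dividing by [4 tau^2] gives
    [sq_bias]. *)
Lemma central_diff_bias x i :
  (central_diff g tau x i - grad f x 0 i) ^+ 2 <= bias2.
Proof.
have noise y : - Delta <= delta y <= Delta.
  by rewrite -ler_norml -(ler_sqr (normr_ge0 _)) ?nnegrE ?(ltW Delta_gt0).
have /andP[p1 p2] := noise (x + tau *: ebasis i).
have /andP[m1 m2] := noise (x - tau *: ebasis i).
have := descent L_gt0 df sf x (- (tau *: ebasis i)).
have := descent L_gt0 df sf x (tau *: ebasis i).
rewrite !dotpE dotp_ebasis_diag dotp_ebasis !mulr1 mulrN opprK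
  -!expr2 !ler_norml.
move=> /andP[a1 a2] /andP[b1 b2].
pose num := g (x + tau *: ebasis i) - g (x - tau *: ebasis i)
            - 2 * tau * grad f x 0 i.
have nM : `|num| <= L * tau ^+ 2 + 2 * Delta.
  by rewrite ler_norml /num; apply/andP; split; lra.
have M0 : 0 <= L * tau ^+ 2 + 2 * Delta := le_trans (normr_ge0 _) nM.
have sq : num ^+ 2 <= 2 * (L * tau ^+ 2) ^+ 2 + 8 * Delta ^+ 2.
  rewrite -real_normK ?num_real//.
  have : `|num| ^+ 2 <= (L * tau ^+ 2 + 2 * Delta) ^+ 2 by rewrite ler_sqr.
  move/le_trans; apply; have := sqr_ge0 (L * tau ^+ 2 - 2 * Delta); nra.
have t0 : tau != 0 by rewrite gt_eqF.
have -> : central_diff g tau x i - grad f x 0 i = num / (2 * tau).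
  by rewrite /central_diff /num; field.
rewrite /sq_bias expr_div_n ler_pdivrMr ?exprn_gt0 ?mulr_gt0//.
apply: le_trans sq _; rewrite le_eqVlt; apply/orP; left; apply/eqP; field.
exact: t0.
Qed.

Lemma full_approxE x i : full_approx g tau x 0 i = central_diff g tau x i.
Proof.
rewrite summxE (bigD1 i)//= big1 ?addr0 => [|j ji]; rewrite !mxE eqxx/=.
  by rewrite eqxx mulr1.
by rewrite eq_sym (negbTE ji) mulr0.
Qed.

Lemma full_approx_bias x :
  dotp (full_approx g tau x - grad f x) (full_approx g tau x - grad f x)
  <= d%:R * bias2.
Proof.
rewrite -[d in d%:R]card_ord mulr_natl -sumr_const.
apply: ler_sum => i _.
have -> : (full_approx g tau x - grad f x) 0 i = central_diff g tau x i - grad f x 0 i.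
  by rewrite mxE full_approxE [in LHS]mxE.
by rewrite -expr2 central_diff_bias.
Qed.

Lemma jaguar_update_err x h p i :
  dotp (jaguar_update g tau x h i - p) (jaguar_update g tau x h i - p)
  = dotp (h - p) (h - p) - (h - p) 0 i ^+ 2
    + (central_diff g tau x i - p 0 i) ^+ 2.
Proof.
have -> : jaguar_update g tau x h i - p
    = (h - p) + (central_diff g tau x i - h 0 i) *: ebasis i.
  rewrite /jaguar_update dotp_ebasis scalerBl -[LHS]addrA [LHS]addrACA [RHS]addrACA.
  by congr (_ + _); rewrite addrC.
have : (h - p) 0 i = h 0 i - p 0 i by rewrite !mxE.
move: (h - p) => u ui; rewrite !dotpE dotp_ebasis_diag (dotpC (ebasis i)).
by rewrite dotp_ebasis ui; ring.
Qed.

(** Each update removes one squared coordinate of the error; over all [i] the removed ones add up to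
    the whole squared norm, hence the factor [d - 1]. *)
Lemma jaguar_update_err_sum x h :
  \sum_(i < d) dotp (jaguar_update g tau x h i - grad f x)
                    (jaguar_update g tau x h i - grad f x)
  <= (d%:R - 1) * dotp (h - grad f x) (h - grad f x) + d%:R * bias2.
Proof.
under eq_bigr do rewrite jaguar_update_err.
rewrite big_split sumrB sumr_const card_ord /= mulrBl mul1r.
apply: lerD.
  by rewrite -[in leLHS]mulr_natl lerD2l lerN2; apply: ler_sum => i _; rewrite expr2.
rewrite -[d in d%:R]card_ord mulr_natl -sumr_const.
by apply: ler_sum => i _; exact: central_diff_bias.
Qed.

Definition jaguar_potential (s : 'rV[R]_d * 'rV[R]_d) : R :=
  f s.1 - fstar
  + 2 * gamma * d%:R * dotp (s.2 - grad f s.1) (s.2 - grad f s.1).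

Definition jaguar_step (s : 'rV[R]_d * 'rV[R]_d) (i : 'I_d) :=
  let h := jaguar_update g tau s.1 s.2 i in (s.1 - gamma *: h, h).

Let D_ge1 : 1 <= d%:R :> R. Proof. by rewrite ler1n. Qed.
Let D_gt0 : 0 < d%:R :> R. Proof. by rewrite ltr0n. Qed.

Let gamma_gt0 : 0 < gamma.
Proof. by rewrite gamma_def divr_gt0 ?mulr_gt0. Qed.

Let gammaE : d%:R * (L * gamma) = 4^-1.
Proof. by rewrite gamma_def; field; rewrite !gt_eqF ?ltr0n. Qed.

Lemma jaguar_potential_ge0 s : 0 <= jaguar_potential s.
Proof.
rewrite /jaguar_potential addr_ge0 ?subr_ge0 ?(fmin.2 _)//.
by do 3!(rewrite mulr_ge0 ?dotp_ge0 ?(ltW gamma_gt0)//).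
Qed.

(** Deterministic in [h]: the new error is [u + w], where [w] is the drift of the gradient,
    controlled by [L gamma |h|] and absorbed by the negative |h|^2 term of the descent. *)
Lemma potential_descent x h : jaguar_potential (x - gamma *: h, h)
  <= (1 - gamma * mu) * (f x - fstar)
     + gamma * (2 * d%:R + 3 / 2) * dotp (h - grad f x) (h - grad f x).
Proof.
rewrite /jaguar_potential /=.
set x' := x - gamma *: h.
set u := h - grad f x; set w := grad f x - grad f x'.
have -> : h - grad f x' = u + w by rewrite /u /w addrA subrK.
rewrite dotp_sqrD.
have := smooth_sqr L_gt0 sf x x'.
have -> : x - x' = gamma *: h by rewrite /x' subKr.
rewrite -/w !(dotpZl, dotpZr).
have := descent L_gt0 df sf x (- (gamma *: h)).
rewrite -/x' ler_norml !(dotpNl, dotpNr, dotpZl, dotpZr) => /andP[_].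
have := plf x; rewrite sqr_enorm.
have : dotp u u = dotp h h - 2 * dotp (grad f x) h + dotp (grad f x) (grad f x).
  by rewrite /u dotp_sqrD !(dotpNl, dotpNr) (dotpC h); ring.
(* With this weight the cross term, once multiplied by [2 d], costs only one extra |u|^2; a cost of
   order [d] would destroy the contraction by 1 - 1/d. *)
have := dotp_young ((2 * d%:R)^-1) u w.
have := dotp_ge0 w; have := dotp_ge0 h; have := dotp_ge0 u.
set U := dotp u u; set H := dotp h h; set W := dotp w w; set P := dotp _ (grad f x).
set uw := dotp u w; set ph := dotp (grad f x) h.
set F := f x - fstar; set F' := f x'.
move=> U0 H0 W0 Y UE PLx dsc sm.
move: (D_ge1) (D_gt0) (gammaE); set D : R := d%:R in Y *.
set q := L * gamma => D1 D0 qE.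
have q0 : 0 < q by rewrite mulr_gt0.
have q4 : q <= 4^-1 by rewrite -qE ler_peMl// ltW.
have Y' : 2 * D * (2 * uw) <= U + (2 * D) ^+ 2 * W.
  have -> : 2 * D * (2 * uw) = (2 * D) ^+ 2 * (2 * (2 * D)^-1 * uw).
    by field; rewrite gt_eqF.
  have -> : U + (2 * D) ^+ 2 * W = (2 * D) ^+ 2 * ((2 * D)^-1 ^+ 2 * U + W).
    by field; rewrite gt_eqF.
  by rewrite ler_pM2l ?exprn_gt0 ?mulr_gt0.
have Wq : W <= q ^+ 2 * H
  by have -> : q ^+ 2 * H = L ^+ 2 * (gamma * (gamma * H)) by rewrite /q; ring.
(* As [D * q = 1/4] and [q <= 1/4], the coefficient is q/2 + 1/4 <= 3/8. *)
have DW : (2 * D + (2 * D) ^+ 2) * W <= 3 / 8 * H.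
  apply: (@le_trans _ _ ((2 * D + (2 * D) ^+ 2) * (q ^+ 2 * H))).
    by rewrite ler_wpM2l// addr_ge0 ?sqr_ge0// mulr_ge0// ltW.
  have -> : (2 * D + (2 * D) ^+ 2) * (q ^+ 2 * H)
      = (2 * (D * q) * q + 4 * (D * q) ^+ 2) * H by ring.
  by rewrite qE; apply: ler_wpM2r => //; lra.
have R' : 2 * D * (U + 2 * uw + W) <= (2 * D + 1) * U + 3 / 8 * H.
  by lra.
have qH : q * H <= 4^-1 * H by rewrite ler_wpM2r.
have dsc' : F' - fstar <= F + gamma * (- ph + q / 2 * H).
  by rewrite /F /q; move: dsc; lra.
(* [UE] turns [- ph] into (U - H - P)/2, and PL bounds - P/2 by - mu F. The coefficient of [H]
   becomes q/2 - 1/2 + 3/8 <= 0. *)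
have key : gamma * (- ph + q / 2 * H + ((2 * D + 1) * U + 3 / 8 * H))
   <= gamma * (- mu * F + (2 * D + 3 / 2) * U).
  by rewrite ler_pM2l//; lra.
have := R'; rewrite -(ler_pM2l gamma_gt0); lra.
Qed.

(** The sum over [i] is [d] times the conditional mean over a fresh uniform index. *)
Lemma jaguar_potential_drift (mu_le_L : mu <= L) s :
  \sum_(i < d) jaguar_potential (jaguar_step s i)
  <= d%:R * ((1 - gamma * mu) * jaguar_potential s
             + 7 / 2 * gamma * (d%:R * bias2)).
Proof.
case: s => x h.
apply: le_trans; first by apply: ler_sum => i _; exact: potential_descent.
rewrite /= big_split sumr_const card_ord -mulr_natl -mulr_sumr /=.
rewrite /jaguar_potential/=.
have := jaguar_update_err_sum x h.
set S := \sum_(i < d) _; set r := dotp (h - _) _; set F := f x - fstar.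
have r0 : 0 <= r := dotp_ge0 _.
have b0 : 0 <= bias2 := le_trans (sqr_ge0 _) (central_diff_bias x (Ordinal d_gt0)).
have gmu : d%:R * (gamma * mu) <= 4^-1.
  by rewrite -gammaE (mulrC L) !ler_pM2l.
move: (D_ge1) (D_gt0) gmu; set D : R := d%:R => D1 D0 gmu; set B := D * bias2 => SB.
have B0 : 0 <= B by rewrite mulr_ge0 // ltW.
(* For [r]: (2D + 3/2)(D - 1) <= 2 D^2 - D/2, and [gmu], which rests on [mu <= L], bounds the loss
   2D (D gamma mu) by D/2. For [B]: 2D + 3/2 <= 7/2 D since D >= 1. *)
have key : (2 * D + 3 / 2) * S <= 2 * D * (D - D * (gamma * mu)) * r + 7 / 2 * D * B.
  apply: (@le_trans _ _ ((2 * D + 3 / 2) * ((D - 1) * r + B))).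
    by rewrite ler_pM2l//; lra.
  rewrite mulrDr mulrA lerD// ler_wpM2r//; last lra.
  nra.
have := key; rewrite -(ler_pM2l gamma_gt0); lra.
Qed.

(** PL and [grad_sqr_le] give 2 mu F <= 2 L F for the gap F >= 0. *)
Lemma PL_smooth_trivial : L < mu -> forall x, f x - fstar = 0.
Proof.
move=> Lmu x.
have := le_trans (plf x) _; rewrite sqr_enorm => /(_ _ (grad_sqr_le L_gt0 df sf fmin x)).
have F0 : 0 <= f x - fstar by rewrite subr_ge0 fmin.2.
move=> H; apply/eqP; rewrite eq_le F0 andbT.
have ML : 0 < mu - L by rewrite subr_gt0.
by rewrite -(pmulr_rle0 _ ML); lra.
Qed.

End JaguarStep.

(** * Expectations of functions of a finite-valued random element *)

Section FiniteExpectation.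
Context {R : realType} {disp : measure_display} {T : measurableType disp}.
Variable P : probability T R.

(** The integrand is a finite combination of indicators of the fibres of [Z]. Applied to index
    histories, this accommodates an arbitrary noise function. *)
Lemma expectation_finite {F : finType} (Z : T -> F) (phi : F -> R) :
  (forall t, measurable (Z @^-1` [set t])) -> (forall t, 0 <= phi t) ->
  ('E_P[(fun w => phi (Z w))] = (\sum_t phi t * fine (P (Z @^-1` [set t])))%:E)%E.
Proof.
move=> mZ phi0; rewrite unlock.
under eq_integral => w _.
  have -> : phi (Z w) = \sum_t phi t * \1_(Z @^-1` [set t]) w.
    rewrite (bigD1 (Z w))//= big1 => [|t tZ].
      by rewrite indicE mem_set// mulr1 addr0.
    by rewrite indicE memNset ?mulr0// => /= E; rewrite E eqxx in tZ.
  rewrite -sumEFin; over.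
have mi t : measurable_fun [set: T] (EFin \o (fun w => phi t * \1_(Z @^-1` [set t]) w : R)).
  by apply/measurable_EFinP; apply: measurable_funM => //; exact: measurable_indic.
rewrite ge0_integral_sum//; last first.
  by move=> t w _; rewrite lee_fin mulr_ge0.
rewrite -sumEFin; apply: eq_bigr => t _.
under eq_integral do rewrite EFinM.
rewrite ge0_integralZl_EFin//; last exact/measurable_EFinP/measurable_indic.
by rewrite integral_indic// setIT EFinM fineK ?fin_num_measure.
Qed.

Lemma sum_probability_finite {F : finType} (Z : T -> F) :
  (forall t, measurable (Z @^-1` [set t])) ->
  \sum_t fine (P (Z @^-1` [set t])) = 1.
Proof.
move=> mZ; have := @expectation_finite F Z (cst 1) mZ (fun=> ler01).
rewrite (expectation_cst P 1) => -[->].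
by apply: eq_bigr => t _; rewrite mul1r.
Qed.

End FiniteExpectation.

(** * Drift inequalities for recursions driven by fresh uniform indices *)

Section Drift.
Context {R : realType} {d : nat} {disp : measure_display} {T : measurableType disp}.
Variables (P : probability T R) (I : nat -> T -> 'I_d).
Hypothesis IP : uniform_fresh_sampling P I.

Lemma measurable_past k (t : k.-tuple 'I_d) : measurable (past I k @^-1` [set t]).
Proof.
case: IP => mI _ _.
have -> : past I k @^-1` [set t]
    = \bigcap_(m in [set: 'I_k]) (I m @^-1` [set tnth t m]).
  apply/seteqP; split => w /=.
    by move=> <- m _; rewrite /= tnth_mktuple.
  by move=> H; apply: eq_from_tnth => m; rewrite tnth_mktuple; exact: H.
apply: fin_bigcap_measurable => [|m _]; [exact: finite_finset|exact: mI].
Qed.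

(** Tower property in finite form: independence factors the law of (past, fresh index), and the
    inner average is the conditional mean given the past. *)
Lemma expectation_past_fresh k (phi : k.-tuple 'I_d -> 'I_d -> R) :
  (forall t i, 0 <= phi t i) ->
  ('E_P[(fun w => phi (past I k w) (I k w))]
   = (\sum_t (d%:R^-1 * \sum_i phi t i) * fine (P (past I k @^-1` [set t])))%:E)%E.
Proof.
move=> phi0; case: (IP) => mI uI indep.
pose Z w := (past I k w, I k w).
have ZE (z : k.-tuple 'I_d * 'I_d) :
    Z @^-1` [set z] = (past I k @^-1` [set z.1]) `&` (I k @^-1` [set z.2]).
  by case: z => t i; apply/seteqP; split => w /=; rewrite /Z => -[-> ->].
have mZ z : measurable (Z @^-1` [set z]).
  by rewrite ZE; apply: measurableI; [exact: measurable_past|exact: mI].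
rewrite (@expectation_finite _ _ _ P _ Z (fun z => phi z.1 z.2) mZ)//.
congr EFin; transitivity (\sum_t \sum_i phi t i * fine (P (Z @^-1` [set (t, i)]))).
  by rewrite pair_bigA; apply: eq_bigr => -[].
apply: eq_bigr => t _; rewrite mulrAC mulr_sumr; apply: eq_bigr => i _.
rewrite ZE indep uI fineM ?fin_num_measure//=; last exact: measurable_past.
ring.
Qed.

Lemma adapted_past {S : Type} (step : S -> 'I_d -> S) (X : nat -> T -> S) (s0 : S) :
  (forall w, X 0%N w = s0) -> (forall k w, X k.+1 w = step (X k w) (I k w)) ->
  forall k, exists x : k.-tuple 'I_d -> S, forall w, X k w = x (past I k w).
Proof.
move=> X0 XS; elim=> [|k [x xP]]; first by exists (fun=> s0).
(* The first [k] entries rebuild the previous state; the last one, at [ord_max], is the index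
   [I k]. *)
exists (fun t => step (x [tuple tnth t (widen_ord (leqnSn k) m) | m < k])
                      (tnth t ord_max)) => w.
rewrite XS xP tnth_mktuple; congr (step (x _) _).
by apply: eq_from_tnth => m; rewrite !tnth_mktuple.
Qed.

Lemma expectation_adapted_le {S : Type} (step : S -> 'I_d -> S)
    (X : nat -> T -> S) (s0 : S) (V W : S -> R) :
  (forall w, X 0%N w = s0) -> (forall k w, X k.+1 w = step (X k w) (I k w)) ->
  (forall s, 0 <= V s <= W s) ->
  forall k, ('E_P[(fun w => V (X k w))] <= 'E_P[(fun w => W (X k w))])%E.
Proof.
move=> X0 XS VW k; have [x xP] := adapted_past step X s0 X0 XS k.
have pushE (U : S -> R) : (fun w => U (X k w)) = fun w => U (x (past I k w)).
  by apply/funext => w; rewrite xP.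
have V0 s : 0 <= V s by case/andP: (VW s).
have VleW s : V s <= W s by case/andP: (VW s).
have W0 s : 0 <= W s := le_trans (V0 s) (VleW s).
rewrite !pushE (expectation_finite P _ (fun t => V (x t)) (@measurable_past k))//.
rewrite (expectation_finite P _ (fun t => W (x t)) (@measurable_past k))// lee_fin.
by apply: ler_sum => t _; rewrite ler_wpM2r ?fine_ge0.
Qed.

(** Induction on [k]: averaging the drift over each history gives a' <= rho a + K, whose fixed point
    is K / (1 - rho). *)
Lemma expectation_drift {S : Type} (step : S -> 'I_d -> S) (X : nat -> T -> S)
    (s0 : S) (V : S -> R) (rho K : R) :
  (0 < d)%N ->
  (forall w, X 0%N w = s0) -> (forall k w, X k.+1 w = step (X k w) (I k w)) ->
  (forall s, 0 <= V s) -> 0 <= rho < 1 -> 0 <= K ->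
  (forall s, \sum_i V (step s i) <= d%:R * (rho * V s + K)) ->
  forall k, ('E_P[(fun w => V (X k w))] <= (rho ^+ k * V s0 + K / (1 - rho))%:E)%E.
Proof.
move=> d0 X0 XS V0 /andP[rho0 rho1] K0 drift; elim=> [|k IH].
  have -> : (fun w => V (X 0%N w)) = cst (V s0) by apply/funext => w; rewrite X0.
  rewrite expectation_cst lee_fin expr0 mul1r lerDl divr_ge0// subr_ge0 ltW//.
have [x xP] := adapted_past step X s0 X0 XS k.
have -> : (fun w => V (X k.+1 w)) = fun w => V (step (x (past I k w)) (I k w)).
  by apply/funext => w; rewrite XS xP.
rewrite (expectation_past_fresh _ (fun t i => V (step (x t) i)))// lee_fin.
move: IH; have -> : (fun w => V (X k w)) = fun w => V (x (past I k w)).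
  by apply/funext => w; rewrite xP.
rewrite (expectation_finite P _ (fun t => V (x t)) (@measurable_past k))// lee_fin.
set a := \sum_t _ => aP.
apply: (@le_trans _ _ (rho * a + K)).
  (* Spreading [K] over the histories, of total mass 1, makes the comparison termwise. *)
  have -> : rho * a + K
      = rho * a + K * \sum_t fine (P (past I k @^-1` [set t])).
    by rewrite (sum_probability_finite P _ (@measurable_past k)) mulr1.
  rewrite !mulr_sumr -big_split; apply: ler_sum => t _ /=.
  rewrite mulrA -mulrDl ler_wpM2r ?fine_ge0//.
  by rewrite ler_pdivrMl ?ltr0n.
have : rho * a <= rho * (rho ^+ k * V s0 + K / (1 - rho)) by rewrite ler_wpM2l.
rewrite -(lerD2r K) => /le_trans; apply.
rewrite le_eqVlt; apply/orP; left; apply/eqP; rewrite exprS; field.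
by rewrite subr_eq0 gt_eqF.
Qed.

End Drift.

(** * Assembly of the convergence bound *)

Theorem theorem4 (R : realType) :
  exists C : R, 0 < C /\
  forall (d : nat) (f : 'rV[R]_d -> R) (fstar L mu : R)
    (delta : 'rV[R]_d -> R) (Delta tau : R) (x0 : 'rV[R]_d)
    (disp : measure_display) (T : measurableType disp)
    (P : probability T R) (I : nat -> T -> 'I_d),
  (0 < d)%N ->
  (forall x, differentiable f x) ->
  is_minimum f fstar ->
  0 < L -> smooth L f ->
  0 < mu -> PL mu f fstar ->
  0 < Delta -> (forall x, `|delta x| ^+ 2 <= Delta ^+ 2) ->
  0 < tau ->
  uniform_fresh_sampling P I ->
  forall N : nat,
  ('E_P[(fun w => f (jaguar_iterate (fun x => f x + delta x) tau
                      (1 / (4 * d%:R * L)) x0 (fun k => I k w) N) - fstar)%R]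
   <= (C * ((f x0 - fstar) * expR (- (mu * N%:R / (4 * d%:R * L)))
            + (d%:R * L ^+ 2 * tau ^+ 2 + d%:R * Delta ^+ 2 / tau ^+ 2) / mu)
      )%R%:E)%E.
Proof.
(* The bias enters as B/(2 mu) through the initial potential and as 7/2 B/mu through the geometric
   series, in total 4 B/mu, and B <= 2 A. *)
exists 8; split=> // d f fstar L mu delta Delta tau x0 disp T P I d0 df fmin
  L0 sf mu0 plf Delta0 deltaP tau0 IP N.
have D0 : 0 < d%:R :> R by rewrite ltr0n.
have F0 x : 0 <= f x - fstar by rewrite subr_ge0 fmin.2.
set gamma := 1 / (4 * d%:R * L).
have gdef : gamma = 1 / (4 * d%:R * L) by [].
clearbody gamma.
have g0 : 0 < gamma by rewrite gdef divr_gt0 ?mulr_gt0.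
have D1 : 1 <= d%:R :> R by rewrite ler1n.
set A := d%:R * L ^+ 2 * tau ^+ 2 + d%:R * Delta ^+ 2 / tau ^+ 2.
have A0 : 0 <= A.
  by rewrite addr_ge0 // ?divr_ge0 ?mulr_ge0 ?sqr_ge0// ltW.
have E0 : 0 < expR (- (mu * N%:R / (4 * d%:R * L))) by exact: expR_gt0.
set rhs := 8 * _.
have rhs0 : 0 <= rhs.
  apply: mulr_ge0 => //; apply: addr_ge0; first by rewrite mulr_ge0 // ltW.
  by rewrite divr_ge0 // ltW.
case: (lerP mu L) => [muL|Lmu]; last first.
  have -> : (fun w => f (jaguar_iterate (fun x => f x + delta x) tau gamma x0
                          (I^~ w) N) - fstar) = cst 0.
    apply/funext => w; exact: (PL_smooth_trivial _ _ _ _ df fmin L0 sf plf Lmu).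
  by rewrite expectation_cst lee_fin.
pose g x := f x + delta x.
pose X k w := jaguar g tau gamma x0 (fun k => I k w) k.
pose V := jaguar_potential f fstar gamma.
have V0 s : 0 <= V s by exact: (jaguar_potential_ge0 _ _ _ _ d0 fmin L0 gdef).
pose B := d%:R * sq_bias L Delta tau.
have B0 : 0 <= B by exact: le_trans (dotp_ge0 _) (full_approx_bias _ _ _ _ _ df L0 sf Delta0 deltaP tau0 x0).
have B2 : B <= 2 * A.
  have : 0 <= d%:R * L ^+ 2 * tau ^+ 2 by rewrite !mulr_ge0 ?sqr_ge0// ltW.
  rewrite /A /B /sq_bias -[_ * Delta ^+ 2 / _]mulrA; lra.
have gmu : gamma * mu <= 4^-1.
  rewrite gdef mul1r mulrC ler_pdivrMr ?mulr_gt0//.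
  rewrite !mulrA mulVf// mul1r; apply: le_trans muL _; rewrite ler_peMl// ltW//.
have gmu0 : 0 < gamma * mu by rewrite mulr_gt0.
have XS k w : X k.+1 w = jaguar_step f delta tau gamma (X k w) (I k w).
  by rewrite /X /=; case: jaguar.
have rho : 0 <= 1 - gamma * mu < 1 by apply/andP; split; lra.
have K0 : 0 <= 7 / 2 * gamma * B by rewrite mulr_ge0 // mulr_ge0 // ltW.
have FV s : 0 <= f s.1 - fstar <= V s.
  rewrite F0 lerDl; do 3!(rewrite mulr_ge0 ?dotp_ge0//); exact: ltW.
apply: (le_trans (expectation_adapted_le P I IP (jaguar_step f delta tau gamma) X
  (x0, full_approx g tau x0) (fun s => f s.1 - fstar) V (fun=> erefl) XS FV N)).
apply: (le_trans (expectation_drift P I IP (jaguar_step f delta tau gamma) X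
  (x0, full_approx g tau x0) V _ _ d0 (fun=> erefl) XS V0 rho K0
  (jaguar_potential_drift _ _ _ _ _ _ _ _ d0 df L0 sf plf Delta0 deltaP tau0 gdef muL) N)).
rewrite lee_fin subKr.
set e := expR _ in E0 rhs rhs0 *.
have rhoe : (1 - gamma * mu) ^+ N <= e.
  have -> : e = expR (- (gamma * mu)) ^+ N.
    rewrite -expRM_natl /e; congr expR; rewrite gdef -mulr_natl; field.
    by rewrite !gt_eqF.
  by rewrite lerXn2r ?nnegrE ?expR_ge0 ?expR_ge1Dx//; case/andP: rho.
have rho1 : (1 - gamma * mu) ^+ N <= 1 by rewrite exprn_ile1 //; case/andP: rho => // _ /ltW.
(* The potential weight equals 1/(2L), and [mu <= L] in this branch. *)
have gd : 2 * gamma * d%:R <= 2^-1 / mu.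
  have -> : 2 * gamma * d%:R = 2^-1 / L by rewrite gdef; field; rewrite !gt_eqF.
  by rewrite ler_pM2l// lef_pV2.
have V0B : V (x0, full_approx g tau x0) <= (f x0 - fstar) + 2^-1 / mu * B.
  rewrite lerD2l /=; apply: ler_pM => //; last exact: full_approx_bias.
  - by rewrite mulr_ge0 // mulr_ge0 // ltW.
  - exact: dotp_ge0.
have -> : 7 / 2 * gamma * B / (gamma * mu) = 7 / 2 * (B / mu).
  by field; rewrite !gt_eqF.
have Bmu : B / mu <= 2 * (A / mu) by rewrite mulrA ler_pM2r ?invr_gt0.
have Bmu0 : 0 <= B / mu by rewrite divr_ge0 // ltW.
have Fe : (1 - gamma * mu) ^+ N * (f x0 - fstar) <= e * (f x0 - fstar) by rewrite ler_wpM2r.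
have Fe0 : 0 <= (f x0 - fstar) * e by rewrite mulr_ge0 // ltW.
have P0 : 0 <= (1 - gamma * mu) ^+ N by rewrite exprn_ge0 //; case/andP: rho.
have := ler_wpM2l P0 V0B.
(* The decay of the initial bias is discarded; only the gap at [x0] keeps the exponential factor. *)
have : (1 - gamma * mu) ^+ N * (2^-1 * (B / mu)) <= 2^-1 * (B / mu).
  by rewrite ler_piMl// mulr_ge0.
rewrite /rhs; lra.
Qed.
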